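(* Adding the constraints $$\sum_{i=1}^N\delta_{i,j}^c\ge d+1,\qquad j\in\{1,\dots,P^c\},\quad c\in\{+,-\},$$ to $MILP1(Q)$ reduces the feasible region (viewed as a set of CPWL functions) to a superset of $CPWL^*(S,\varepsilon,P^+,P^-)$. In other words, some non-well-behaved solutions may be eliminated from the new feasible region, but all well-behaved solutions are preserved.
   Context: Let $S=(\bm{x}_i,z_i)_{i=1,\dots,N}$ be a set of $N\ge d+1$ points of $\mathbb{R}^{d+1}$ with $(\bm{x}_i)$ in general position in $\mathbb{R}^d$ (any $d+1$ of them affinely independent), $S_{\mathbb{R}^d}=\{\bm{x}_1,\dots,\bm{x}_N\}$, $D$ the convex hull of $S_{\mathbb{R}^d}$, $\varepsilon\ge 0$, and $P^+,P^-\ge 1$ integers. DC representation: $f=f^+-f^-$ on $D$ with $f^c=\max_{j\in\{1,\dots,P^c\}}f_j^c$, $f_j^c(\bm{x})={\bm{a}_j^c}^T\bm{x}+b_j^c$, $c\in\{+,-\}$. The affine domains of $f^c$ are $D_j^c=\{\bm{x}\in D:f^c(\bm{x})=f_j^c(\bm{x})\}$; by the paper's convention $\{D_j^c\}_j$ is a partition of $D$ (they cover $D$, have non-empty interiors and pairwise disjoint interiors). The affine domains of $f$ are intersections $D_j^+\cap D_k^-$, those with non-empty interior being affine domains of $f$, and on such a domain the affine piece of $f$ is $f_j^+-f_k^-$. $f$ is an $\varepsilon$-approximation of $S$ when $|f(\bm{x}_i)-z_i|\le\varepsilon$ for all $i$. It is well-behaved when each of its affine pieces interpolates at least $d+1$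 points of $(\bm{x}_i,f(\bm{x}_i))_{i=1,\dots,N}$, i.e. each affine domain of $f$ contains at least $d+1$ points of $S_{\mathbb{R}^d}$. $CPWL(S,\varepsilon,P^+,P^-)$ is the set of CPWL $\varepsilon$-approximations of $S$ that can be represented using $P^+$, $P^-$ affine pieces for $f^+$, $f^-$; $CPWL^*(S,\varepsilon,P^+,P^-)$ is its subset of well-behaved ones. $MILP1(Q)$ is the problem of minimizing a linear objective $Q$ over continuous variables $\bm{a}_j^c\in\mathbb{R}^d$, $b_j^c\in\mathbb{R}$, $f(\bm{x}_i),f^+(\bm{x}_i),f^-(\bm{x}_i),e_i\in\mathbb{R}$ and binary variables $\delta_{i,j}^c\in\{0,1\}$, subject to, for all $i\in\{1,\dots,N\}$, $c\in\{+,-\}$, $j\in\{1,\dots,P^c\}$: $f(\bm{x}_i)=f^+(\bm{x}_i)-f^-(\bm{x}_i)$; $0\le f^c(\bm{x}_i)-{\bm{a}_j^c}^T\bm{x}_i-b_j^c$; $f^c(\bm{x}_i)-{\bm{a}_j^c}^T\bm{x}_i-b_j^c\le M_i^c(1-\delta_{i,j}^c)$; $\sum_{j=1}^{P^c}\delta_{i,j}^c\ge 1$; $-e_i\le f(\bm{x}_i)-z_i\le e_i$; $0\le e_i\le\varepsilon$; with the big-M parameters $M_i^c$ large enough that the constraint containing them is not restrictive when $\delta_{i,j}^c=0$. The feasible region is identified with the set of CPWL functions $f=f^+-f^-$ represented by feasible solutions; for $MILP1(Q)$ this is $CPWL(S,\varepsilon,P^+,P^-)$. *)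

(* Defs.v *)
From HB Require Import structures.
From mathcomp Require Import all_boot all_order all_algebra.
From mathcomp Require Import all_classical all_reals all_analysis.

Set Implicit Arguments.
Unset Strict Implicit.
Unset Printing Implicit Defensive.

Import Order.TTheory GRing.Theory Num.Theory.
Import numFieldNormedType.Exports.

Local Open Scope classical_set_scope.
Local Open Scope ring_scope.

Definition affinely_independent (R : realType) (d n : nat)
    (y : 'I_n -> 'cV[R]_d) : Prop :=
  forall l : 'I_n -> R,
    \sum_i l i = 0 -> \sum_i l i *: y i = 0 -> forall i, l i = 0.

Definition general_position (R : realType) (d N : nat)
    (x : 'I_N -> 'cV[R]_d) : Prop :=
  forall g : 'I_d.+1 -> 'I_N, injective g ->
    affinely_independent (fun k => x (g k)).

Definition convex_hull (R : realType) (d : nat) (A : set 'cV[R]_d) :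
    set 'cV[R]_d :=
  smallest (@convex_set R 'cV[R]_d) A.

Variant side := Plus | Minus.

Definition affine (R : realType) (d : nat) (a : 'cV[R]_d) (b : R)
    (y : 'cV[R]_d) : R :=
  (a^T *m y) 0 0 + b.

(* The default element of the iterated maximum is the first entry, so that this
   is the maximum of the [u j] as soon as [0 < n]; it is 0 for [n = 0]. *)
Definition max_of (R : realType) (n : nat) (u : 'I_n -> R) : R :=
  \big[Num.max/head 0 (codom u)]_(j < n) u j.

Section DC.
Variables (R : realType) (d N : nat).
Variables (x : 'I_N -> 'cV[R]_d) (z : 'I_N -> R) (eps : R) (P : side -> nat).

Definition domain : set 'cV[R]_d := convex_hull (range x).

Section Representation.
Variables (a : forall c, 'I_(P c) -> 'cV[R]_d) (b : forall c, 'I_(P c) -> R).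

Definition convex_part (c : side) (y : 'cV[R]_d) : R :=
  max_of (fun j : 'I_(P c) => affine (a j) (b j) y).

Definition affine_domain (c : side) (j : 'I_(P c)) : set 'cV[R]_d :=
  [set y | domain y /\ convex_part c y = affine (a j) (b j) y].

(* Partition up to boundaries: adjacent pieces share their common face. *)
Definition partition_of_domain (c : side) : Prop :=
  [/\ \bigcup_(j in [set: 'I_(P c)]) affine_domain j = domain,
      forall j : 'I_(P c), (affine_domain j)° !=set0 &
      forall j k : 'I_(P c), j != k ->
        (affine_domain j)° `&` (affine_domain k)° = set0].

(* [f] is a total function, but only its values on [domain] are relevant. *)
Definition DC_representation (f : 'cV[R]_d -> R) : Prop :=
  (forall y, domain y -> f y = convex_part Plus y - convex_part Minus y) /\
  (forall c, partition_of_domain c).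

Definition well_behaved : Prop :=
  forall (j : 'I_(P Plus)) (k : 'I_(P Minus)),
    (affine_domain j `&` affine_domain k)° !=set0 ->
    (d.+1 <= #|[pred i | x i \in affine_domain j `&` affine_domain k]|)%N.

End Representation.

Definition eps_approximation (f : 'cV[R]_d -> R) : Prop :=
  forall i, `|f (x i) - z i| <= eps.

Definition CPWL : set ('cV[R]_d -> R) :=
  [set f | eps_approximation f /\ exists a b, DC_representation a b f].

Definition CPWL_star : set ('cV[R]_d -> R) :=
  [set f | eps_approximation f /\
           exists a b, DC_representation a b f /\ well_behaved a b].

Record milp_point := MilpPoint {
  va : forall c, 'I_(P c) -> 'cV[R]_d;
  vb : forall c, 'I_(P c) -> R;
  vf : 'I_N -> R;
  vfc : side -> 'I_N -> R;
  ve : 'I_N -> R;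
  vdelta : forall c, 'I_N -> 'I_(P c) -> bool
}.

Definition milp1 (M : side -> 'I_N -> R) (v : milp_point) : Prop :=
  forall i : 'I_N,
  [/\ vf v i = vfc v Plus i - vfc v Minus i,
      forall c (j : 'I_(P c)),
        0 <= vfc v c i - ((va v j)^T *m x i) 0 0 - vb v j,
      forall c (j : 'I_(P c)),
        vfc v c i - ((va v j)^T *m x i) 0 0 - vb v j
          <= M c i * (1 - (vdelta v i j)%:R),
      forall c, (1 <= \sum_(j < P c) vdelta v i j)%N &
      - ve v i <= vf v i - z i <= ve v i /\ 0 <= ve v i <= eps].

Definition count_constraints (v : milp_point) : Prop :=
  forall c (j : 'I_(P c)), (d.+1 <= \sum_(i < N) vdelta v i j)%N.

(* The big-M parameters only have to be large enough.  Since the slacks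
   f^c(x_i) - a_j^c . x_i - b_j^c are unbounded over CPWL, no real M is
   non-restrictive for all points at once; hence a point is feasible when it
   satisfies the constraints for all sufficiently large M. *)
Definition milp1_feasible (v : milp_point) : Prop :=
  exists M0 : side -> 'I_N -> R,
    forall M, (forall c i, M0 c i <= M c i) -> milp1 M v.

Definition represented_by (F : set milp_point) : set ('cV[R]_d -> R) :=
  [set f | exists2 v, F v & DC_representation (va v) (vb v) f].

Definition milp1_region : set ('cV[R]_d -> R) :=
  represented_by milp1_feasible.

Definition milp1_count_region : set ('cV[R]_d -> R) :=
  represented_by (milp1_feasible `&` count_constraints).

End DC.

(* Main.v *)
(* On the interior of an affine domain of [f^+] (resp. [f^-]) the affine domains
   of the other part form a finite closed cover, so one of them has interior
   there (a finite instance of Baire's theorem).  The resulting piece of [f]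
   contains [d+1] data points by well-behavedness, and they all lie in the
   affine domain we started from.  Taking for [delta] the indicator of
   membership in the affine domains therefore satisfies the new constraints. *)
Require Import Defs.
From mathcomp Require Import all_boot all_order all_algebra.
From mathcomp Require Import all_classical all_reals all_analysis.

Set Implicit Arguments.
Unset Strict Implicit.
Unset Printing Implicit Defensive.

Import Order.TTheory GRing.Theory Num.Theory.
Import numFieldNormedType.Exports.

Local Open Scope classical_set_scope.
Local Open Scope ring_scope.

(** Induction on the list of closed sets. Either the first one contains all of [U], or removing it
    from [U] leaves a non-empty open set covered by the remaining ones. The empty list cannot cover
    a non-empty [U]. *)
Lemma finite_closed_cover_interior (T : topologicalType) (I : eqType)
    (s : seq I) (C : I -> set T) (U : set T) :
    (forall i, closed (C i)) -> open U -> U !=set0 ->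
    (forall y, U y -> exists2 i, i \in s & C i y) ->
  exists i, (U `&` C i)° !=set0.
Proof.
move=> Ccl; elim: s U => [|i s IHs] U Uop [y Uy] Ucov.
  by have [i] := Ucov y Uy.
have [UC|/existsNP[w /not_implyP[Uw Cw]]] := pselect (U `<=` C i).
  exists i, y; rewrite (_ : U `&` C i = U) ?interior_id//.
  by move/interior_id: Uop => ->.
  by apply/setIidPl.
have [|||k [v Vv]] := IHs (U `&` ~` C i).
- by apply: openI => //; exact: closed_openC.
- by exists w.
- move=> v [Uv Cv]; have [k] := Ucov v Uv.
  by rewrite inE => /orP[/eqP->//|ks Ckv]; exists k.
by exists k, v; apply: interiorS Vv; apply: setSI => u [].
Qed.

Lemma le_max_of (R : realType) (n : nat) (u : 'I_n -> R) (j : 'I_n) :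
  u j <= max_of u.
Proof. exact: le_bigmax. Qed.

(** Being an entry of [u] is preserved by binary maxima, and the default value of the iterated
    maximum is itself an entry when [0 < n]. *)
Lemma max_of_attained (R : realType) (n : nat) (u : 'I_n -> R) :
  (0 < n)%N -> exists j, max_of u = u j.
Proof.
move=> n_gt0; rewrite /max_of; elim/big_ind: _ => [|v w|j _]; last by exists j.
  have : head 0 (codom u) \in codom u.
    have := size_codom u; rewrite card_ord.
    by case: (codom u) => [n0|v s _]; [rewrite -n0 in n_gt0|rewrite mem_head].
  by case/codomP=> j ->; exists j.
by move=> Hv Hw; rewrite /Num.max; case: ifP.
Qed.

Lemma affine_continuous (R : realType) (d : nat) (a : 'cV[R]_d) (b : R) :
  continuous (affine a b).
Proof.
rewrite (_ : affine a b = fun y => \sum_i a i 0 * y i 0 + b); last first.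
  apply/funext => y; rewrite /affine mxE; congr (_ + _).
  by apply: eq_bigr => i _; rewrite mxE.
move=> y; apply: (@cvgD _ _ _ (nbhs y)); last exact: cvg_cst.
apply: (@cvg_big _ _ _ _ _ _ _ (nbhs y)) => [|i _]; first exact: add_continuous.
by apply: (@cvgM _ _ (nbhs y)); [exact: cvg_cst|exact: coord_continuous].
Qed.

Section AffineDomains.
Variables (R : realType) (d N : nat) (x : 'I_N -> 'cV[R]_d) (P : side -> nat).
Variables (a : forall c, 'I_(P c) -> 'cV[R]_d) (b : forall c, 'I_(P c) -> R).
Arguments a : clear implicits.
Arguments b : clear implicits.

Lemma domain_point i : domain x (x i).
Proof. by move=> A [_]; apply; exists i. Qed.

(** The set is a finite intersection of closed half-spaces, one for each piece that [j] must
    dominate. Leaving [domain] out of it avoids any appeal to closedness of the convex hull. *)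
Lemma closed_convex_part_eq c (j : 'I_(P c)) :
  closed [set y | convex_part a b c y = affine (a c j) (b c j) y].
Proof.
rewrite (_ : [set _ | _] = \bigcap_(k in [set: 'I_(P c)])
   [set y | affine (a c k) (b c k) y <= affine (a c j) (b c j) y]).
  apply: closed_bigI => k _.
  rewrite (_ : [set _ | _] = (fun y => affine (a c j) (b c j) y
      - affine (a c k) (b c k) y) @^-1` [set r | 0 <= r]); last first.
    by apply/seteqP; split=> y /=; rewrite subr_ge0.
  apply: preimage_closed; last exact: closed_ge.
  by move=> y _; apply: (@cvgB _ _ _ (nbhs y)); exact: affine_continuous.
apply/seteqP; split=> y /=.
  move=> jE k _ /=; rewrite -jE.
  exact: (le_max_of (fun k => affine (a c k) (b c k) y)).
move=> le_j; have := max_of_attained (fun k => affine (a c k) (b c k) y).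
(* The index [j] witnesses that [P c] is positive, so the maximum is attained. *)
move=> /(_ (leq_ltn_trans (leq0n j) (ltn_ord j)))[k].
rewrite /convex_part => maxE; apply/le_anti.
rewrite {1}maxE le_j//=.
exact: (le_max_of (fun k => affine (a c k) (b c k) y)).
Qed.

Lemma affine_domains_overlap c c' (j : 'I_(P c)) :
    partition_of_domain x a b c -> partition_of_domain x a b c' ->
  exists k : 'I_(P c'),
    (affine_domain x a b j `&` affine_domain x a b k)° !=set0.
Proof.
move=> [_ /(_ j) Dj0 _] [Dcov _ _].
have [|k [y Vy]] := finite_closed_cover_interior (s := enum 'I_(P c'))
  (@closed_convex_part_eq c') (@open_interior _ (affine_domain x a b j)) Dj0.
  move=> y /interior_subset[Dy _]; move: Dy; rewrite -Dcov => -[k _ [_ Ck]].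
  by exists k; rewrite ?mem_enum.
(* The closed sets of the cover do not mention [domain]; membership in it is recovered from the
   affine domain of [j]. *)
exists k, y; apply: interiorS Vy => u [/interior_subset Dju Cu].
by split=> //; split=> //; case: Dju.
Qed.

Lemma well_behaved_card c (j : 'I_(P c)) :
    (forall c, partition_of_domain x a b c) -> well_behaved x a b ->
  (d.+1 <= #|[pred i | x i \in affine_domain x a b j]|)%N.
Proof.
move=> part wb; case: c j => j.
  have [k /wb Hk] := affine_domains_overlap j (part Plus) (part Minus).
  apply: leq_trans Hk _; apply: subset_leq_card; apply/fintype.subsetP => i.
  by rewrite !inE => -[].
have [k] := affine_domains_overlap j (part Minus) (part Plus).
rewrite setIC => /wb Hk.
apply: leq_trans Hk _; apply: subset_leq_card; apply/fintype.subsetP => i.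
by rewrite !inE => -[].
Qed.

Definition membership_point (z : 'I_N -> R) : milp_point R d N P :=
  let f i := convex_part a b Plus (x i) - convex_part a b Minus (x i) in
  MilpPoint a b f (fun c i => convex_part a b c (x i))
    (fun i => `|f i - z i|) (fun c i j => x i \in affine_domain x a b j).

Lemma membership_point_feasible (z : 'I_N -> R) (eps : R) :
    (forall c, (0 < P c)%N) ->
    (forall i, `|convex_part a b Plus (x i) - convex_part a b Minus (x i)
                 - z i| <= eps) ->
  milp1_feasible x z eps (membership_point z).
Proof.
move=> P_gt0 feps.
pose slack c i (j : 'I_(P c)) :=
  convex_part a b c (x i) - ((a c j)^T *m x i) 0 0 - b c j.
have slackE c i j : slack c i j =
    convex_part a b c (x i) - affine (a c j) (b c j) (x i).
  by rewrite /slack /affine opprD addrA.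
have slack_ge0 c i j : 0 <= slack c i j.
  rewrite slackE subr_ge0.
  exact: (le_max_of (fun k => affine (a c k) (b c k) (x i))).
(* Since slacks are nonnegative, their sum at [x i] bounds each of them, so any larger [M] makes the
   big-M constraint hold when [delta] is 0. When [delta] is 1 the slack vanishes. *)
exists (fun c i => \sum_j slack c i j) => M leM i; split=> //=.
- by move=> c j; exact: slack_ge0.
- move=> c j; rewrite -/(slack c i j).
  have [|] := boolP (x i \in _).
    by rewrite inE => -[_ eq_j]; rewrite subrr mulr0 slackE eq_j subrr.
  move=> _; rewrite subr0 mulr1; apply: le_trans (leM c i).
  by rewrite (bigD1 j)//= lerDl sumr_ge0.
- move=> c.
  (* A piece attaining the maximum at [x i] has [x i] in its affine domain, so its [delta] is 1. *)
  have [j maxE] := max_of_attained (fun k => affine (a c k) (b c k) (x i)) (P_gt0 c).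
  rewrite (bigD1 j)//= mem_set//.
  by split; [exact: domain_point|].
- by split; [rewrite -ler_norml|rewrite normr_ge0 feps].
Qed.

Lemma membership_point_count (z : 'I_N -> R) :
    (forall c, partition_of_domain x a b c) -> well_behaved x a b ->
  count_constraints (membership_point z).
Proof.
move=> part wb c j; apply: leq_trans (well_behaved_card j part wb) _.
by rewrite -sum1_card big_mkcond /=; apply: leq_sum => i _; rewrite inE; case: ifP.
Qed.

End AffineDomains.

Theorem theorem4 (R : realType) (d N : nat)
    (x : 'I_N -> 'cV[R]_d) (z : 'I_N -> R) (eps : R) (P : side -> nat)
    (hN : (d.+1 <= N)%N) (hx : general_position x)
    (heps : 0 <= eps) (hP : forall c, (1 <= P c)%N) :
  milp1_count_region x z eps P `<=` milp1_region x z eps P /\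
  CPWL_star x z eps P `<=` milp1_count_region x z eps P.
Proof.
split; first by move=> f [v [v_feas _] f_rep]; exists v.
move=> f [feps [a [b [f_rep wb]]]]; exists (membership_point x a b z) => //.
case: f_rep => fE part; split; last exact: membership_point_count.
apply: membership_point_feasible => // i.
(* The representation of [f] holds only on [domain], which contains the data points. *)
by rewrite -fE; [exact: feps|exact: domain_point].
Qed.
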